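(* Let $X$ be a metric space with integer valued metric. Let $A\in\mathscr A(X)$ and assume $1\le n:=\mathrm{rk}(A)<\infty$. Then: (1) the set $P(A)\subset H(A)\subset\mathbb{R}^X$ is an injective $n$-dimensional polytope (with respect to the sup-norm metric on $H(A)$); (2) the interior of $P(A)$ relative to $H(A)$ is the set $\{g\in\mathrm{E}'(X): A(g)=A\}$; (3) the faces of $P(A)$ are precisely the sets $P(A')$ with $A'\in\mathscr A(X)$ and $A\subset A'$.
   Context: For $f\colon X\to\mathbb{R}$, $A(f)$ is the set of unordered pairs $\{x,y\}$ ($x=y$ allowed) with $f(x)+f(y)=d(x,y)$. $\Delta(X)=\{f\in\mathbb R^X: f(x)+f(y)\ge d(x,y)\ \forall x,y\}$; $\mathrm{E}'(X)=\{f\in\Delta(X):\bigcup A(f)=X\}$; $\mathscr A(X)=\{A(f): f\in\mathrm{E}'(X)\}$; for $A\in\mathscr A(X)$, $H(A)=\{g\in\mathbb{R}^X: g(x)+g(y)=d(x,y)\ \forall \{x,y\}\in A\}$, $\mathrm{rk}(A)=\dim H(A)$, and $P(A)=\mathrm{E}'(X)\cap H(A)$. When $\mathrm{rk}(A)$ is finite, differences of elements of $H(A)$ are bounded and $H(A)$ is metrized by $\|g-h\|_\infty=\sup_x|g(x)-h(x)|$. Polytopes are convex and compact; a metric space is injective if 1-Lipschitz maps into it from subsets of metric spaces extend 1-Lipschitz. *)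

(* Defs.v *)
From mathcomp Require Import all_boot all_order all_algebra.
From mathcomp Require Import all_classical all_reals.
Set Implicit Arguments. Unset Strict Implicit. Unset Printing Implicit Defensive.
Import Order.TTheory GRing.Theory Num.Theory.
Local Open Scope ring_scope.
Local Open Scope classical_set_scope.

Section Defs.
Variables (R : realType) (X : Type).

Definition is_metric (Y : Type) (dY : Y -> Y -> R) : Prop :=
  (forall x y, dY x y = 0 <-> x = y) /\
  (forall x y, dY x y = dY y x) /\
  (forall x y z, dY x z <= dY x y + dY y z).

Definition int_valued (d : X -> X -> R) : Prop :=
  forall x y, exists z : int, d x y = z%:~R.

(* Sets of unordered pairs {x,y} are encoded as symmetric sets of ordered pairs. *)
Definition Aset (d : X -> X -> R) (f : X -> R) : set (X * X) :=
  [set p | f p.1 + f p.2 = d p.1 p.2].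

Definition Delta (d : X -> X -> R) : set (X -> R) :=
  [set f | forall x y, d x y <= f x + f y].

Definition Eprime (d : X -> X -> R) : set (X -> R) :=
  [set f | Delta d f /\ forall x, exists y, Aset d f (x, y)].

Definition scrA (d : X -> X -> R) : set (set (X * X)) :=
  [set A | exists f, Eprime d f /\ Aset d f = A].

Definition H (d : X -> X -> R) (A : set (X * X)) : set (X -> R) :=
  [set g | forall p, A p -> g p.1 + g p.2 = d p.1 p.2].

Definition P (d : X -> X -> R) (A : set (X * X)) : set (X -> R) :=
  Eprime d `&` H d A.

Definition aff_indep (m : nat) (p : 'I_m -> X -> R) : Prop :=
  forall c : 'I_m -> R, \sum_(i < m) c i = 0 ->
    (forall x, \sum_(i < m) c i * p i x = 0) -> forall i, c i = 0.

Definition in_aff_span (m : nat) (p : 'I_m -> X -> R) (g : X -> R) : Prop :=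
  exists c : 'I_m -> R, \sum_(i < m) c i = 1 /\
    forall x, g x = \sum_(i < m) c i * p i x.

Definition in_conv_hull (m : nat) (p : 'I_m -> X -> R) (g : X -> R) : Prop :=
  exists c : 'I_m -> R, (forall i, 0 <= c i) /\ \sum_(i < m) c i = 1 /\
    forall x, g x = \sum_(i < m) c i * p i x.

Definition affine_dim (S : set (X -> R)) (n : nat) : Prop :=
  exists p : 'I_n.+1 -> X -> R, (forall i, S (p i)) /\ aff_indep p /\
    (forall g, S g -> in_aff_span p g).

Definition rk_eq (d : X -> X -> R) (A : set (X * X)) (n : nat) : Prop :=
  affine_dim (H d A) n.

Definition is_polytope (S : set (X -> R)) : Prop :=
  exists (m : nat) (p : 'I_m -> X -> R), forall g, S g <-> in_conv_hull p g.

Definition supdist (g h : X -> R) : R := sup (range (fun x => `|g x - h x|)).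

Definition injective_sup (S : set (X -> R)) : Prop :=
  forall (Y : Type) (dY : Y -> Y -> R), is_metric dY ->
  forall (T : set Y) (f : Y -> X -> R),
    (forall y, T y -> S (f y)) ->
    (forall y y', T y -> T y' -> supdist (f y) (f y') <= dY y y') ->
    exists F : Y -> X -> R,
      (forall y, S (F y)) /\ (forall y, T y -> F y = f y) /\
      (forall y y', supdist (F y) (F y') <= dY y y').

Definition rel_interior (E S : set (X -> R)) : set (X -> R) :=
  [set g | S g /\ exists e : R, 0 < e /\
     forall h, E h -> supdist g h < e -> S h].

Definition convex_set (S : set (X -> R)) : Prop :=
  forall g h t, S g -> S h -> 0 <= t <= 1 ->
    S (fun x => (1 - t) * g x + t * h x).

(* (nonempty) face of a convex set, in the sense of Rockafellar *)
Definition is_face (S F : set (X -> R)) : Prop :=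
  (exists g, F g) /\ F `<=` S /\ convex_set F /\
  forall g h t, S g -> S h -> 0 < t < 1 ->
    F (fun x => (1 - t) * g x + t * h x) -> F g /\ F h.

End Defs.

(* Main.v *)
(* Let V be the direction space of H(A). A vector of V stays in V when it is cut off
outside a class of points whose evaluations on V agree up to sign, so finite rank leaves
only finitely many evaluations on V. For half-integral g0 in H(A), the values
g0(x) + g0(y) - d(x,y) are half-integers, so among the pairs with given evaluations one
gives the sharpest inequality: P(A) is cut out of H(A) by finitely many inequalities.
The polytope, face and interior statements then follow by moving along lines in H(A) until
a new inequality becomes tight.

For injectivity, every constraint bounds a difference of two signed coordinates
g(x), -g(x). With E(b,a) the infimum of g_b - g_a over P(A), a map f on T extends to
q_a(y) = inf (f(k)_b + dY(y,k) - E(b,a)) over k in T and all b, so q_a - q_b >= E(a,b).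
Writing -x for the negated coordinate, averaging the bounds for (x,-y) and (y,-x) shows
that x |-> (q_x - q_{-x})/2 lies in P(A). *)
Require Import Defs.
From mathcomp Require Import all_boot all_order all_algebra.
From mathcomp Require Import all_classical all_reals.
From mathcomp Require Import ring lra.
Import Order.TTheory GRing.Theory Num.Theory.
Local Open Scope ring_scope.
Local Open Scope classical_set_scope.

(** * Finite rank: finitely many evaluations on the direction space *)

Section FiniteRank.
Set Implicit Arguments. Unset Strict Implicit.
Variables (R : realType) (X : Type) (d : X -> X -> R) (A : set (X * X)).

Definition slack (p : X * X) (g : X -> R) : R := g p.1 + g p.2 - d p.1 p.2.

Definition dir : set (X -> R) := [set v | forall p, A p -> v p.1 + v p.2 = 0].

Lemma dir_sub g h : H d A g -> H d A h -> dir (fun x => g x - h x).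
Proof.
move=> Hg Hh p Ap; have := Hg p Ap; have := Hh p Ap => e1 e2.
by rewrite addrACA -opprD e1 e2 subrr.
Qed.

Lemma H_translate g v t : H d A g -> dir v -> H d A (fun x => g x + t * v x).
Proof.
move=> Hg dv p Ap; rewrite addrACA -mulrDr (dv p Ap) mulr0 addr0.
exact: Hg.
Qed.

Lemma H_slack0 g p : H d A g -> A p -> slack p g = 0.
Proof. by move=> Hg Ap; rewrite /slack (Hg p Ap) subrr. Qed.

(** The sign is forced: an edge [{y,z}] of [A] gives [v y = - v z], so only agreement up to a
    uniform sign is invariant along edges. *)
Definition dir_equiv (x y : X) : Prop :=
  (forall v, dir v -> v x = v y) \/ (forall v, dir v -> v x = - v y).

Lemma dir_equiv_edge x y z : A (y, z) -> dir_equiv x y -> dir_equiv x z.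
Proof.
move=> Ayz.
have yz v : dir v -> v y = - v z by move=> dv; apply/eqP; rewrite -addr_eq0 (dv _ Ayz).
by case=> xy; [right|left] => v dv; rewrite xy // yz ?opprK.
Qed.

Lemma dir_equiv_edgeC x y z : A (y, z) -> dir_equiv x z -> dir_equiv x y.
Proof.
move=> Ayz.
have yz v : dir v -> v z = - v y.
  by move=> dv; apply/eqP; rewrite -addr_eq0 addrC (dv _ Ayz).
by case=> xy; [right|left] => v dv; rewrite xy // yz ?opprK.
Qed.

(* Edges of [A] never leave an equivalence class, so [dir] splits as a product over the classes. *)
Lemma dir_restrict x v : dir v -> dir (fun y => if `[< dir_equiv x y >] then v y else 0).
Proof.
move=> dv [y z] Ayz /=.
case: asboolP => [xy|nxy]; case: asboolP => [xz|nxz].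
- exact: dv Ayz.
- by case: nxz; exact: dir_equiv_edge Ayz xy.
- by case: nxy; exact: dir_equiv_edgeC Ayz xz.
- by rewrite addr0.
Qed.

(** Only the values of [r] below [m] count; a total sequence lets families of different lengths
    share one type. *)
Definition indep_points (m : nat) (r : nat -> X) : Prop :=
  (forall i, (i < m)%N -> exists2 v, dir v & v (r i) != 0) /\
  (forall i j, (i < m)%N -> (j < m)%N -> i != j -> ~ dir_equiv (r i) (r j)).

Variable n : nat.
Hypothesis hrk : rk_eq d A n.

(** Subtract the affine coordinates of [p ord0] from those of [p ord0 + v]. The zero sum confines
    [b] to an [n]-dimensional space. *)
Lemma dir_coords : exists p : 'I_n.+1 -> X -> R, forall v, dir v ->
  exists b : 'I_n.+1 -> R, \sum_i b i = 0 /\ forall x, v x = \sum_i b i * p i x.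
Proof.
have [p [Hp [_ span]]] := hrk; exists p => v dv.
have [c [c1 cE]] := span _ (Hp ord0).
have [c' [c1' cE']] := span _ (H_translate 1 (Hp ord0) dv).
exists (fun i => c' i - c i); split; first by rewrite sumrB c1 c1' subrr.
move=> x; under eq_bigr do rewrite mulrBl.
by rewrite sumrB -cE -cE' mul1r addrAC subrr add0r.
Qed.

(** Cutting directions off outside the class of each [r i] yields [n.+1] vectors dual to these
    points up to scaling, hence independent: too many for rank [n]. *)
Lemma indep_points_bound r : ~ indep_points n.+1 r.
Proof.
move=> [nz ne].
have [p coords] := dir_coords.
have /choice[w wP] : forall i : 'I_n.+1, exists w, [/\ dir w,
    w (r i) != 0 & forall j : 'I_n.+1, j != i -> w (r j) = 0].
  move=> i; have [v dv v0] := nz i (ltn_ord i).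
  exists (fun y => if `[< dir_equiv (r i) y >] then v y else 0); split.
  - exact: dir_restrict.
  - by case: asboolP => // -[]; left.
  - move=> j ji; case: asboolP => // rij; case: (ne i j) => //.
    by rewrite eq_sym.
have /choice[b bP] : forall i, exists b : 'I_n.+1 -> R,
    \sum_j b j = 0 /\ forall x, w i x = \sum_j b j * p j x.
  by move=> i; apply: coords; case: (wP i).
(* The rows of [B] sum to zero, so [B] is singular. A left kernel vector [l] is a linear relation
   between the [w i]; evaluating it at [r j] gives [l j = 0]. *)
pose B : 'M[R]_n.+1 := \matrix_(i, j) b i j.
have : \det B = 0.
  rewrite -det_tr; apply/eqP/det0P; exists (const_mx 1).
    apply/eqP => /rowP/(_ ord0); rewrite !mxE => /eqP.
    by rewrite oner_eq0.
  apply/rowP => i; rewrite !mxE -[RHS](bP i).1.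
  by apply: eq_bigr => j _; rewrite !mxE mul1r.
move/eqP/det0P => [l l0 lB]; case/negP: l0; apply/eqP/rowP => j; rewrite !mxE.
have lw x : \sum_i l ord0 i * w i x = 0.
  under eq_bigr => i _ do rewrite (bP i).2 mulr_sumr.
  rewrite exchange_big big1 // => k _ /=.
  under eq_bigr do rewrite mulrA.
  rewrite -mulr_suml; have /rowP/(_ k) := lB; rewrite !mxE => lk.
  have -> : \sum_i l ord0 i * b i k = 0.
    by rewrite -[RHS]lk; apply: eq_bigr => i _; rewrite mxE.
  by rewrite mul0r.
have := lw (r j); rewrite (bigD1 j) //= big1 => [|i ij].
  by rewrite addr0 => /eqP; case: (wP j) => _ /negbTE w0 _; rewrite mulf_eq0 w0 orbF => /eqP.
by case: (wP i) => _ _ ->; rewrite ?mulr0 // eq_sym.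
Qed.

Lemma maximal_indep_points : X -> exists m r, indep_points m r /\ ~ exists r', indep_points m.+1 r'.
Proof.
move=> x0; apply: contrapT => noM.
have step m : exists r, indep_points m r.
  elim: m => [|m [r rP]]; first by exists (fun=> x0); split.
  by apply: contrapT => nr; apply: noM; exists m, r.
by have [r /indep_points_bound] := step n.+1.
Qed.

(** By maximality of the family [r], each evaluation is zero or plus or minus the one at some [r i];
    the type records which. *)
Lemma finite_types : exists (T : finType) (c : X -> T),
  forall x y, c x = c y -> forall v, dir v -> v x = v y.
Proof.
have [[x0]|noX] := pselect (inhabited X); last first.
  by exists unit, (fun=> tt) => x; case: noX.
have [m [r [[rnz rne] rmax]]] := maximal_indep_points x0.
have cover x : (forall v, dir v -> v x = 0) \/ exists i : 'I_m, dir_equiv (r i) x.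
  apply: contrapT => /not_orP[xnz xne]; apply: rmax.
  (* An uncovered [x], placed at index [m], would lengthen the maximal family. *)
  exists (fun i => if (i < m)%N then r i else x); split.
    move=> i im; case: ifP => [|_]; first exact: rnz.
    apply: contrapT => nv; apply: xnz => v dv.
    by apply: contrapT => /eqP vx; apply: nv; exists v.
  have xr i : (i < m)%N -> ~ dir_equiv (r i) x.
    by move=> im e; apply: xne; exists (Ordinal im).
  have rx i : (i < m)%N -> ~ dir_equiv x (r i).
    move=> im [] e; apply: (xr i im); [left|right] => v dv; rewrite e //.
    by rewrite opprK.
  move=> i j; rewrite !ltnS => im jm ij.
  case: ifP => [im'|/negbT im']; case: ifP => [jm'|/negbT jm'].
  - exact: rne.
  - exact: xr.
  - exact: rx.
  - case/negP: ij; rewrite -!leqNgt in im' jm'.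
    by rewrite eqn_leq (leq_trans im jm') (leq_trans jm im').
have /choice[c cP] : forall x, exists t : option ('I_m * bool),
    match t with
    | None => forall v, dir v -> v x = 0
    | Some (i, s) => forall v, dir v -> v x = (if s then v (r i) else - v (r i))
    end.
  move=> x; case: (cover x) => [x0'|[i [e|e]]]; first by exists None.
    by exists (Some (i, true)) => v dv; rewrite e.
  by exists (Some (i, false)) => v dv; rewrite e // opprK.
exists (option ('I_m * bool)), c => x y cxy v dv.
by have := cP x; have := cP y; rewrite cxy; case: (c y) => [[i s]|] e1 e2;
  rewrite e1 ?e2.
Qed.

Lemma dir_bounded v : dir v -> exists B, forall x, `|v x| <= B.
Proof.
move=> dv; have [T [c cP]] := finite_types.
have /choice[w wP] : forall t, exists y, forall x, c x = t -> v x = y.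
  move=> t; have [[x0 e0]|nx] := pselect (exists x, c x = t).
    by exists (v x0) => x e; apply: cP => //; rewrite e e0.
  by exists 0 => x e; case: nx; exists x.
exists (\sum_t `|w t|) => x; rewrite (wP _ _ erefl) (bigD1 (c x)) //= lerDl.
exact: sumr_ge0.
Qed.

End FiniteRank.

(** * Reduction to finitely many inequalities *)

Section FiniteSlacks.
Set Implicit Arguments. Unset Strict Implicit.
Variables (R : realType) (X : Type) (d : X -> X -> R) (A : set (X * X)).
Hypothesis hint : int_valued d.

(* [t |-> (floor t + ceil t) / 2] is odd and commutes with integer translations, so it preserves the equations of [H d A]. *)
Lemma H_round f : H d A f ->
  H d A (fun x => ((Num.floor (f x))%:~R + (Num.ceil (f x))%:~R) / 2).
Proof.
move=> Hf p Ap; have [z dz] := hint p.1 p.2.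
have -> : f p.2 = z%:~R + - f p.1 by rewrite -dz -(Hf p Ap) addrAC subrr add0r.
rewrite floorDzr ?intr_int // ceilDzr ?intr_int // !intrKfloor !intrKceil.
have -> : Num.floor (- f p.1) = - Num.ceil (f p.1) by rewrite ceilNfloor opprK.
have -> : Num.ceil (- f p.1) = - Num.floor (f p.1) by rewrite floorNceil opprK.
by rewrite dz !intrD !intrN; field.
Qed.

Lemma finite_slacks n f : rk_eq d A n -> H d A f -> Delta d f ->
  exists (K : finType) (pr : K -> X * X), forall p, exists k c,
    0 <= c /\ forall g, H d A g -> slack d p g = slack d (pr k) g + c.
Proof.
move=> hrk Hf Df; have [T [c cP]] := finite_types hrk.
have [[p0]|nop] := pselect (inhabited (X * X)); last first.
  by exists void, (fun v : void => match v with end) => p; case: nop.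
pose g0 x : R := ((Num.floor (f x))%:~R + (Num.ceil (f x))%:~R) / 2.
have Hg0 : H d A g0 := H_round Hf.
pose ty (p : X * X) := (c p.1, c p.2).
have diffE p q g h : ty p = ty q -> H d A g -> H d A h ->
    slack d p g - slack d q g = slack d p h - slack d q h.
  move=> [e1 e2] Hg Hh; have dv := dir_sub Hg Hh.
  have := cP _ _ e1 _ dv; have := cP _ _ e2 _ dv; rewrite /slack => {}e1 {}e2.
  by lra.
have int_slack p : exists z : int, slack d p g0 = z%:~R / 2.
  have [z dz] := hint p.1 p.2.
  exists (Num.floor (f p.1) + Num.ceil (f p.1) + Num.floor (f p.2) + Num.ceil (f p.2) - 2 * z).
  by rewrite /slack dz /g0 !(intrD, intrN, intrM); field.
have /choice[pr prP] : forall t, exists q, forall p, ty p = t ->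
    ty q = t /\ slack d q g0 <= slack d p g0.
  move=> t; have [[p1 tp1]|not_t] := pselect (exists p, ty p = t); last first.
    by exists p0 => p tp; case: not_t; exists p.
  pose B := [set z : int | exists p, ty p = t /\ slack d p g0 = z%:~R / 2].
  have [z [[q [tq qz]] zmin]] : exists j, B j /\ forall k, B k -> j <= k.
    (* Equal types make the change of slack from [f] to [g0] the same at [p] and [p1]; slacks of [f]
       are nonnegative since [f] lies in [Delta], which bounds the numerators below. *)
    apply: (@int_lbound_has_minimum _ (Num.floor (2 * (slack d p1 g0 - slack d p1 f)))).
      by have [z zE] := int_slack p1; exists z, p1.
    move=> z [p [tp zE]]; rewrite -(ler_int R); apply: le_trans (floor_le _) _.
    have := @diffE p p1 _ _ _ Hg0 Hf; rewrite tp tp1 => /(_ erefl).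
    have : 0 <= slack d p f by rewrite subr_ge0; exact: Df.
    by rewrite zE; lra.
  exists q => p tp; split=> //; have [z' z'E] := int_slack p.
  rewrite qz z'E ler_pM2r ?invr_gt0 // ler_int; apply: zmin.
  by exists p.
exists (T * T)%type, pr => p; exists (ty p), (slack d p g0 - slack d (pr (ty p)) g0).
have [tq le_q] := prP _ _ (erefl (ty p)).
split=> [|g Hg]; first by rewrite subr_ge0.
by rewrite -(@diffE p _ g) // addrC subrK.
Qed.

End FiniteSlacks.

(** * Slacks, tight constraints and moving to the boundary of a cell *)

Section Cells.
Set Implicit Arguments. Unset Strict Implicit.
Variables (R : realType) (X : Type) (d : X -> X -> R).

Lemma slack_line p g v t :
  slack d p (fun x => g x + t * v x) = slack d p g + t * (v p.1 + v p.2).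
Proof. by rewrite /slack; ring. Qed.

Lemma slack_conv p g h t :
  slack d p (fun x => (1 - t) * g x + t * h x) = (1 - t) * slack d p g + t * slack d p h.
Proof. by rewrite /slack; ring. Qed.

Lemma slack_comb (m : nat) (q : 'I_m -> X -> R) (c : 'I_m -> R) p g :
  \sum_i c i = 1 -> (forall x, g x = \sum_i c i * q i x) ->
  slack d p g = \sum_i c i * slack d p (q i).
Proof.
move=> c1 gE; rewrite /slack !gE -[X in _ - X]mul1r -c1 mulr_suml -big_split -sumrB.
by apply: eq_bigr => i _ /=; rewrite mulrBr mulrDr.
Qed.

Lemma slack_eq0 p g : slack d p g = 0 <-> Aset d g p.
Proof. by split=> [/subr0_eq|gp] //; rewrite /slack gp subrr. Qed.

(** The covering condition of [Eprime] is inherited: [A = A(f)] already covers [X], and its pairs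
    have slack zero at [g]. *)
Lemma PE A g : scrA d A -> P d A g <->
  (forall p, A p -> slack d p g = 0) /\ forall p, 0 <= slack d p g.
Proof.
move=> [f [[Df cov] Af]]; split.
  move=> [[Dg _] Hg]; split=> p; first exact: H_slack0.
  by rewrite subr_ge0; exact: Dg.
move=> [g0 gge]; have Hg : H d A g by move=> p /g0/subr0_eq.
split=> //; split.
  by move=> x y; rewrite -subr_ge0; exact: (gge (x, y)).
by move=> x; have [y fxy] := cov x; exists y; apply: (Hg (x, y)); rewrite -Af.
Qed.

Lemma P_convex A : scrA d A -> convex_set (P d A).
Proof.
move=> hA g h t /(PE _ hA)[g0 gge] /(PE _ hA)[h0 hge] t01.
apply/(PE _ hA); split=> p; rewrite slack_conv; first by move=> Ap; rewrite g0 ?h0 ?mulr0 ?addr0.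
by have := gge p; have := hge p => ? ?; apply: addr_ge0; apply: mulr_ge0 => //; lra.
Qed.

Lemma P_hull A (m : nat) (q : 'I_m -> X -> R) g : scrA d A ->
  (forall i, P d A (q i)) -> in_conv_hull q g -> P d A g.
Proof.
move=> hA Pq [c [c0 [c1 gE]]]; apply/(PE _ hA).
split=> p => [Ap|]; rewrite (slack_comb _ c1 gE).
  by apply: big1 => i _; have /(PE _ hA)[q0 _] := Pq i; rewrite q0 // mulr0.
by apply: sumr_ge0 => i _; have /(PE _ hA)[_ qge] := Pq i; rewrite mulr_ge0.
Qed.

(** A combination of nonnegative slacks with positive weights vanishes only if each of them does. *)
Lemma P_face A A' : scrA d A -> scrA d A' -> A `<=` A' -> is_face (P d A) (P d A').
Proof.
move=> hA hA' AA'; split; last split; last split.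
- by case: (hA') => g [Eg <-]; exists g; split=> // p.
- by move=> g [Eg Hg]; split=> // p /AA'; exact: Hg.
- exact: P_convex.
- move=> g h t /(PE _ hA)[_ gge] /(PE _ hA)[_ hge] t01 /(PE _ hA')[gh0 _].
  have gh p : A' p -> slack d p g = 0 /\ slack d p h = 0.
    move/gh0; rewrite slack_conv => /eqP.
    rewrite paddr_eq0; [|by apply: mulr_ge0 => //; lra..].
    have t0 : t == 0 = false by apply/negbTE; rewrite gt_eqF //; lra.
    have t1 : 1 - t == 0 = false by apply/negbTE; rewrite gt_eqF //; lra.
    by rewrite !mulf_eq0 t0 t1 => /andP[/eqP-> /eqP->].
  by split; apply/(PE _ hA'); split=> // p /gh[].
Qed.

Lemma hull_convex (m : nat) (q : 'I_m -> X -> R) : convex_set (in_conv_hull q).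
Proof.
move=> g h t [a [a0 [a1 gE]]] [b [b0 [b1 hE]]] t01.
exists (fun i => (1 - t) * a i + t * b i); split.
  by move=> i; apply: addr_ge0; apply: mulr_ge0 => //; lra.
split; first by rewrite big_split -!mulr_sumr a1 b1 /=; lra.
move=> x; rewrite gE hE !mulr_sumr -big_split.
by apply: eq_bigr => i _ /=; ring.
Qed.

Lemma hull_point (m : nat) (q : 'I_m -> X -> R) i : in_conv_hull q (q i).
Proof.
exists (fun j => (j == i)%:R); split; first by move=> j; rewrite ler0n.
split; first by rewrite (bigD1 i) //= eqxx big1 ?addr0 // => j /negbTE ->.
move=> x; rewrite (bigD1 i) //= eqxx mul1r big1 ?addr0 // => j /negbTE ->.
by rewrite mul0r.
Qed.

Hypothesis hd : is_metric d.

(** A partner [y] of [x] in [A] gives [g x = d x y - g y], and [Delta] contains only nonnegative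
    functions because [d z z = 0]. *)
Lemma P_pointwise_bounded A : scrA d A -> forall x, exists M, forall g, P d A g -> 0 <= g x <= M.
Proof.
move=> [f [[Df cov] Af]] x; have [y fxy] := cov x.
have ge0 g z : Delta d g -> 0 <= g z.
  by have [/(_ z z) d0 _] := hd; move=> /(_ z z); rewrite (d0.2 erefl); lra.
exists (d x y) => g [[Dg _] Hg]; rewrite ge0 //=.
have := ge0 _ y Dg; have : A (x, y) by rewrite -Af.
by move=> /Hg /=; lra.
Qed.

Variables (A : set (X * X)) (K : finType) (pr : K -> X * X).
Hypothesis hA : scrA d A.
Hypothesis hK : forall p, exists k c,
  0 <= c /\ forall g, H d A g -> slack d p g = slack d (pr k) g + c.

Lemma P_finE g : P d A g <-> H d A g /\ forall k, 0 <= slack d (pr k) g.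
Proof.
split=> [Pg|[Hg gge]].
  by split; [case: Pg|have /(PE _ hA)[] := Pg].
apply/(PE _ hA); split=> p; first exact: H_slack0.
by have [k [c [c0 cE]]] := hK p; rewrite cE // addr_ge0.
Qed.

(** A finite stand-in for [A(g)], whose cardinality can drive inductions and minimality
    arguments. *)
Definition tight (g : X -> R) : {set K} := [set k | slack d (pr k) g == 0]%SET.

Lemma tightP g k : reflect (slack d (pr k) g = 0) (k \in tight g).
Proof. by rewrite inE; exact: eqP. Qed.

(** In [slack p g = slack (pr k) g + c] both terms are nonnegative, so [p] is tight only when
    [c = 0] and [k] is tight. *)
Lemma tight_Aset g h : P d A g -> P d A h ->
  tight g \subset tight h <-> Aset d g `<=` Aset d h.
Proof.
move=> /P_finE[Hg gge] /P_finE[Hh hge]; split=> [/fintype.subsetP sub p /slack_eq0|sub].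
  have [k [c [c0 cE]]] := hK p; rewrite cE // => sum0.
  have gk : slack d (pr k) g = 0 by have := gge k; lra.
  have c00 : c = 0 by lra.
  by apply/slack_eq0; rewrite cE // c00 addr0; apply/tightP/sub/tightP.
by apply/fintype.subsetP => k /tightP/slack_eq0/sub/slack_eq0/tightP.
Qed.

(** Follow [v] until the first decreasing slack reaches zero; constraints tight at [g] stay tight
    because their slacks are constant along [v]. *)
Lemma exit_point g v : P d A g -> dir A v -> (exists x, v x <> 0) ->
  (forall k, k \in tight g -> v (pr k).1 + v (pr k).2 = 0) ->
  exists t, [/\ 0 < t, P d A (fun x => g x + t * v x) &
    tight g \proper tight (fun x => g x + t * v x)].
Proof.
move=> Pg dv [x vx] vtight; have /P_finE[Hg gge] := Pg.
pose l k := v (pr k).1 + v (pr k).2.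
(* Were no slack decreasing, the whole ray would stay in [P]; at time [(M + 1) / |v x|] its
   coordinate at [x] has left [[0, M]]. *)
have [k0 lk0] : exists k, l k < 0.
  apply: contrapT => noneg.
  have lge k : 0 <= l k by rewrite leNgt; apply/negP => lk; apply: noneg; exists k.
  have ray t : 0 <= t -> P d A (fun x => g x + t * v x).
    move=> t0; apply/P_finE; split; first exact: H_translate.
    by move=> k; rewrite slack_line addr_ge0 // mulr_ge0 // lge.
  have [M MP] := P_pointwise_bounded hA x.
  have /andP[g0 gM] := MP _ Pg.
  have t0 : 0 <= (M + 1) / `|v x| by apply: divr_ge0 => //; lra.
  have /andP[] := MP _ (ray _ t0).
  have [vx0|vx0|//] := ltgtP (v x) 0.
    by rewrite ltr0_norm // invrN mulrN mulNr divfK ?lt_eqF //; lra.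
  by rewrite gtr0_norm // divfK ?gt_eqF //; lra.
(* The ratio is the time at which constraint [k] becomes tight; [k1] is hit first. *)
pose k1 := [arg min_(k < k0 | l k < 0) (slack d (pr k) g / - l k)]%O.
have [lk1 k1min] : l k1 < 0 /\ forall k, l k < 0 ->
    slack d (pr k1) g / - l k1 <= slack d (pr k) g / - l k.
  by rewrite /k1; case: arg_minP.
have gk1 : 0 < slack d (pr k1) g.
  rewrite lt_neqAle gge andbT eq_sym; apply/eqP => /tightP/vtight.
  by move: lk1; rewrite /l => lk1 e; rewrite e ltxx in lk1.
pose t := slack d (pr k1) g / - l k1.
have t0 : 0 < t by rewrite divr_gt0 // oppr_gt0.
exists t; split=> //.
  apply/P_finE; split; first exact: H_translate.
  move=> k; rewrite slack_line; have [lk|lk] := ltP (l k) 0.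
    by have := k1min _ lk; rewrite -/t ler_pdivlMr ?oppr_gt0 // mulrN -/(l k); lra.
  by rewrite addr_ge0 // mulr_ge0 // ltW.
apply/fintype.properP; split.
  apply/fintype.subsetP => k kg; apply/tightP.
  by rewrite slack_line vtight // mulr0 addr0; apply/tightP.
exists k1; last by apply/negP => /tightP e; rewrite e ltxx in gk1.
apply/tightP; rewrite slack_line -/(l k1) /t invrN mulrN mulNr divfK ?subrr //.
by rewrite lt_eqF.
Qed.

End Cells.

(** * The supremum distance *)

Section SupDistance.
Set Implicit Arguments. Unset Strict Implicit.
Variables (R : realType) (X : Type).

(** [0 <= c] covers empty [X], where the supremum of the empty set is 0 by convention. *)
Lemma supdist_le (g h : X -> R) c : 0 <= c -> (forall x, `|g x - h x| <= c) -> supdist g h <= c.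
Proof.
move=> c0 gh; rewrite /supdist.
have [[x0]|noX] := pselect (inhabited X).
  by apply: ge_sup; [exists `|g x0 - h x0|, x0|move=> z [x _ <-]].
suff -> : range (fun x => `|g x - h x|) = set0 by rewrite sup0.
by apply/seteqP; split=> // z [x _ _]; case: noX.
Qed.

(** The uniform bound guards against the default value that [sup] takes on unbounded sets. *)
Lemma le_supdist (g h : X -> R) B x : (forall x, `|g x - h x| <= B) -> `|g x - h x| <= supdist g h.
Proof.
move=> gh; apply: ub_le_sup; last by exists x.
by exists B => _ [y _ <-].
Qed.

End SupDistance.

(** * Vertices, faces and neighbourhoods *)

Section CellStructure.
Set Implicit Arguments. Unset Strict Implicit.
Variables (R : realType) (X : Type) (d : X -> X -> R).
Variables (A : set (X * X)) (K : finType) (pr : K -> X * X).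
Hypothesis hd : is_metric d.
Hypothesis hA : scrA d A.
Hypothesis hK : forall p, exists k c,
  0 <= c /\ forall g, H d A g -> slack d p g = slack d (pr k) g + c.

Let tight := tight d pr.

Lemma neq_fun_sub (g h : X -> R) : h <> g -> exists x, h x - g x <> 0.
Proof.
move=> hg; apply: contrapT => all0; apply: hg; apply/funext => x.
by apply: contrapT => gx; apply: all0; exists x => /subr0_eq.
Qed.

Lemma tight_sub g h k : tight g \subset tight h -> k \in tight g ->
  (h (pr k).1 - g (pr k).1) + (h (pr k).2 - g (pr k).2) = 0.
Proof.
move=> /fintype.subsetP sub kg; have := sub _ kg; move: kg.
by move=> /tightP + /tightP; rewrite /slack; lra.
Qed.

(** Vertices are the points determined within [P] by their tight sets, so they are finitely many.
    Any other point lies on a segment between two points with more tight constraints. *)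
Lemma P_polytope : is_polytope (P d A).
Proof.
pose vertex g := P d A g /\ forall h, P d A h -> tight g \subset tight h -> h = g.
have [f [Ef Af]] := hA; have Pf : P d A f by split=> // p; rewrite -Af.
(* Subsets that are not the tight set of a vertex receive the default point [f], which adds nothing
   outside [P] to the hull. *)
have /choice[v vP] : forall S : {set K}, exists v, P d A v /\
    forall g, vertex g -> tight g = S -> v = g.
  move=> S; have [[g [vg <-]]|nv] := pselect (exists g, vertex g /\ tight g = S).
    exists g; split; first by case: vg.
    by move=> h [Ph hmin] e; apply: hmin; [case: vg|rewrite e].
  by exists f; split=> // g vg gS; case: nv; exists g.
exists #|{set K}|, (fun i => v (enum_val i)) => g; split; last first.
  by apply: P_hull => // i; case: (vP (enum_val i)).
(* Induction on the number of constraints that are not tight. *)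
have [N] := ubnP #|~: tight g|; elim: N g => // N IH g gN Pg.
have [vg|nvg] := pselect (vertex g).
  have := hull_point (fun i => v (enum_val i)) (enum_rank (tight g)).
  by rewrite enum_rankK; case: (vP (tight g)) => _ /(_ g vg erefl) ->.
have [h [Ph gh hg]] : exists h, [/\ P d A h, tight g \subset tight h & h <> g].
  apply: contrapT => noh; apply: nvg; split=> // h Ph sub.
  by apply: contrapT => hg; apply: noh; exists h.
have [_ Hg] := Pg; have [_ Hh] := Ph.
have dv := dir_sub Hh Hg; have dv' := dir_sub Hg Hh.
have [x vx] := neq_fun_sub hg.
have [t1 [t10 P1 T1]] := exit_point hd hA hK Pg dv (ex_intro _ x vx) (fun k => tight_sub gh (k:=k)).
have [t2 [t20 P2 T2]] : exists t, [/\ 0 < t, P d A (fun x => g x + t * (g x - h x)) &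
    tight g \proper tight (fun x => g x + t * (g x - h x))].
  apply: exit_point => //; first by exists x; lra.
  by move=> k /(tight_sub gh); lra.
have card_lt g' : tight g \proper tight g' -> (#|~: tight g'| < N)%N.
  by move=> lt; rewrite -ltnS; apply: leq_trans gN; rewrite ltnS proper_card // properC.
(* The exit points are [g + t1 (h - g)] and [g - t2 (h - g)]; this weight on the second one recovers
   [g]. *)
have t01 : 0 <= t1 / (t1 + t2) <= 1.
  by rewrite ler_pdivlMr ?ler_pdivrMr; lra.
have := hull_convex (IH _ (card_lt _ T1) P1) (IH _ (card_lt _ T2) P2) t01.
suff -> : (fun y => (1 - t1 / (t1 + t2)) * (g y + t1 * (h y - g y)) +
    t1 / (t1 + t2) * (g y + t2 * (g y - h y))) = g by [].
by apply/funext => y; field; rewrite gt_eqF // addr_gt0.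
Qed.

(** A point [g] of [F] with the fewest tight constraints is relatively interior to [F], and
    [A' = A(g)] works. *)
Lemma face_P F : is_face (P d A) F ->
  exists A', scrA d A' /\ A `<=` A' /\ F = P d A'.
Proof.
move=> [[f Ff] [FP [Fconv Fext]]].
have [g Fg gmin] : exists2 g, F g & forall h, F h -> (#|tight g| <= #|tight h|)%N.
  have [|j [[g Fg <-] jmin]] := @nat_has_minimum [set #|tight g| | g in F].
    by exists #|tight f|, f.
  by exists g => // h Fh; apply: jmin; exists h.
have Pg := FP _ Fg; have [Eg Hg] := Pg.
have Fsub h : F h -> tight g \subset tight h.
  move=> Fh; have [_ /(PE _ hA)[_ gge]] := (Fh, Pg).
  have [_ hge] := (PE _ hA).1 (FP _ Fh).
  (* The midpoint is tight only where both [g] and [h] are, so minimality at [g] forces [tight g]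
     into [tight h]. *)
  pose mid x := (1 - 2^-1) * g x + 2^-1 * h x.
  have Fmid : F mid by apply: Fconv => //; lra.
  have mid0 k : k \in tight mid -> k \in tight g /\ k \in tight h.
    move=> /tightP; rewrite slack_conv => e.
    by have := gge (pr k); have := hge (pr k); split; apply/tightP; lra.
  have sub : tight mid \subset tight g by apply/fintype.subsetP => k /mid0[].
  have /eqP <- : tight mid == tight g by rewrite eqEcard sub gmin.
  by apply/fintype.subsetP => k /mid0[].
exists (Aset d g); split; first by exists g.
have AAg : A `<=` Aset d g by move=> p /Hg.
split=> //; apply/seteqP; split=> h.
  move=> Fh; have Ph := FP _ Fh; split; first by case: Ph.
  exact: (tight_Aset hA hK Pg Ph).1 (Fsub _ Fh).
move=> [Eh Hh]; have [->//|/neq_fun_sub[x hgx]] := pselect (h = g).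
have Ph : P d A h by split=> // p /AAg/Hh.
have gh : tight g \subset tight h by apply/(tight_Aset hA hK Pg Ph).
have [_ HAh] := Ph.
(* Prolonging the segment from [h] beyond [g] inside [P] puts [g] in an open segment ending at [h];
   the face property then gives [h] in [F]. *)
have [t [t0 Pt _]] : exists t, [/\ 0 < t, P d A (fun x => g x + t * (g x - h x)) &
    tight g \proper tight (fun x => g x + t * (g x - h x))].
  apply: exit_point => //; first exact: dir_sub Hg HAh.
    by exists x; lra.
  by move=> k /(tight_sub gh); lra.
have s01 : 0 < t / (1 + t) < 1 by rewrite ltr_pdivlMr ?ltr_pdivrMr; lra.
have [] // := Fext _ _ _ Pt Ph s01.
suff -> : (fun x0 => (1 - t / (1 + t)) * (g x0 + t * (g x0 - h x0)) + t / (1 + t) * h x0) = g by [].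
by apply/funext => y; field; rewrite gt_eqF // addr_gt0.
Qed.

Lemma P_nbhs g : P d A g -> Aset d g = A ->
  exists e, 0 < e /\ forall h, H d A h -> (forall x, `|g x - h x| <= e) -> P d A h.
Proof.
move=> Pg gA; have /(P_finE hA hK)[Hg gge] := Pg.
(* Moving two coordinates by at most half the slack keeps it nonnegative. Tight indices belong to
   [A], where slack is zero on all of [H]; their value 1 is a placeholder. *)
pose e k := if slack d (pr k) g == 0 then 1 else slack d (pr k) g / 2.
exists (\big[Num.min/1]_k e k); split.
  apply: lt_bigmin => // k _; rewrite /e; case: eqP => // /eqP gk.
  by rewrite divr_gt0 // lt_neqAle eq_sym gk gge.
move=> h Hh gh; apply/(P_finE hA hK); split=> // k.
have le_e x : `|g x - h x| <= e k by apply: le_trans (gh x) (bigmin_le _ _ _).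
have [gk|gk] := eqVneq (slack d (pr k) g) 0.
  by rewrite (H_slack0 Hh) // -gA; apply/slack_eq0.
have := le_e (pr k).1; have := le_e (pr k).2; rewrite /e (negbTE gk) /slack.
by rewrite !ler_norml => /andP[? ?] /andP[? ?]; lra.
Qed.

End CellStructure.

(** * Dimension and relative interior *)

Section Dimension.
Set Implicit Arguments. Unset Strict Implicit.
Variables (R : realType) (X : Type) (d : X -> X -> R).
Variables (A : set (X * X)) (K : finType) (pr : K -> X * X) (n : nat).
Hypothesis hd : is_metric d.
Hypothesis hA : scrA d A.
Hypothesis hrk : rk_eq d A n.
Hypothesis hK : forall p, exists k c,
  0 <= c /\ forall g, H d A g -> slack d p g = slack d (pr k) g + c.

Lemma H_bounded g h : H d A g -> H d A h -> exists2 B, 0 <= B & forall x, `|g x - h x| <= B.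
Proof.
move=> Hg Hh; have [B BP] := dir_bounded hrk (dir_sub Hg Hh).
by exists `|B| => // x; apply: le_trans (BP x) (ler_norm B).
Qed.

Lemma sum_homothety (m : nat) (c : 'I_m -> R) (q : 'I_m -> X -> R) f e x :
  \sum_i c i * (f x + e * (q i x - f x)) =
  (\sum_i c i) * ((1 - e) * f x) + e * \sum_i c i * q i x.
Proof.
rewrite mulr_suml mulr_sumr -big_split; apply: eq_bigr => i _ /=; ring.
Qed.

(** A homothety centred at [f], where [A(f) = A], shrinks an affine basis of [H] into a
    neighbourhood of [f] contained in [P]. *)
Lemma P_affine_dim : affine_dim (P d A) n.
Proof.
have [f [Ef Af]] := hA; have Hf : H d A f by move=> p; rewrite -Af.
have [e [e0 eP]] := P_nbhs hA hK (conj Ef Hf) Af.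
have [q [Hq [ind span]]] := hrk.
have /choice[B BP] : forall i, exists B, 0 <= B /\ forall x, `|q i x - f x| <= B.
  by move=> i; have [B B0 BP] := H_bounded (Hq i) Hf; exists B.
pose M := 1 + \sum_i B i.
have B0 : 0 <= \sum_i B i by apply: sumr_ge0 => i _; case: (BP i).
have M0 : 0 < M by rewrite /M; lra.
have BM i : B i <= M.
  rewrite /M (bigD1 i) //=; suff : 0 <= \sum_(j < n.+1 | j != i) B j by lra.
  by apply: sumr_ge0 => j _; case: (BP j).
pose s := e / M; have s0 : 0 < s by exact: divr_gt0.
exists (fun i x => f x + s * (q i x - f x)); split; last split.
- move=> i; apply: eP; first by apply: H_translate => //; exact: dir_sub (Hq i) Hf.
  move=> x; rewrite opprD addrA subrr add0r normrN normrM gtr0_norm //.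
  rewrite /s mulrAC ler_pdivrMr // ler_pM2l //.
  by case: (BP i) => _ /(_ x) /le_trans; exact.
- move=> c c0 cq; apply: ind => // x; have := cq x.
  rewrite sum_homothety c0 mul0r add0r => /eqP.
  by rewrite mulf_eq0 gt_eqF //= => /eqP.
- move=> g [_ Hg].
  (* The inverse homothety sends [g] to a point of [H], whose affine coordinates serve for [g]. *)
  have [c [c1 cE]] := span _ (H_translate s^-1 Hf (dir_sub Hg Hf)).
  exists c; split=> // x; rewrite sum_homothety c1 -cE mul1r.
  by field; rewrite gt_eqF.
Qed.

(** If a pair outside [A] were tight at [g], a small step from [g] directly away from [f] would stay
    in [H] but make its slack negative. *)
Lemma P_rel_interior g :
  rel_interior (H d A) (P d A) g <-> Eprime d g /\ Aset d g = A.
Proof.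
split=> [[Pg [e [e0 eP]]]|[Eg gA]]; last first.
  have Hg : H d A g by move=> p; rewrite -gA.
  have [e [e0 eP]] := P_nbhs hA hK (conj Eg Hg) gA.
  split=> //; exists e; split=> // h Hh ghe; apply: eP => // x.
  have [B _ BP] := H_bounded Hg Hh.
  by apply: le_trans (le_supdist x BP) (ltW ghe).
have [f [Ef Af]] := hA; have Hf : H d A f by move=> p; rewrite -Af.
have [Eg Hg] := Pg; split=> //; apply/seteqP; split=> [p gp|p /Hg //].
have [_ fge] := (PE f hA).1 (conj Ef Hf).
rewrite -Af; apply/slack_eq0/eqP; apply: contrapT => /negP fp.
have fp0 : 0 < slack d p f by rewrite lt_neqAle eq_sym fp fge.
have [B B0 BP] := H_bounded Hg Hf.
have [s s0 sB] : exists2 s, 0 < s & s * B <= e / 2.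
  (* [B + 1] avoids division by zero; half of [e] leaves room for the strict inequality. *)
  exists (e / 2 / (B + 1)); first by rewrite !divr_gt0 //; lra.
  by rewrite mulrAC ler_pdivrMr; [rewrite ler_pM2l; lra|lra].
have Hh : H d A (fun x => g x + s * (g x - f x)) by apply: H_translate => //; exact: dir_sub Hg Hf.
have /(eP _ Hh)/(PE _ hA)[_ /(_ p)] : supdist g (fun x => g x + s * (g x - f x)) < e.
  have : supdist g (fun x => g x + s * (g x - f x)) <= e / 2.
    apply: supdist_le => [|x]; first lra.
    rewrite opprD addrA subrr add0r normrN normrM gtr0_norm //.
    by apply: le_trans sB; rewrite ler_pM2l.
  by lra.
have /slack_eq0 gp0 := gp.
have -> : slack d p (fun x => g x + s * (g x - f x)) = (1 + s) * slack d p g - s * slack d p f.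
  by rewrite /slack; ring.
by rewrite gp0 mulr0 sub0r oppr_ge0 leNgt mulr_gt0.
Qed.

End Dimension.

(** * Injectivity by extension of signed coordinates *)

Section Injectivity.
Set Implicit Arguments. Unset Strict Implicit.
Variables (R : realType) (X : Type) (d : X -> X -> R) (A : set (X * X)) (n : nat).
Hypothesis hd : is_metric d.
Hypothesis hA : scrA d A.
Hypothesis hrk : rk_eq d A n.

(* A signed point [(x, s)] stands for the coordinate [g x] or [- g x]; all constraints defining [P d A] then bound differences of two coordinates. *)
Definition coord (g : X -> R) (a : X * bool) : R := if a.2 then g a.1 else - g a.1.

Definition min_diff (b a : X * bool) : R := inf [set coord g b - coord g a | g in P d A].

Lemma min_diff_le g b a : P d A g -> min_diff b a <= coord g b - coord g a.
Proof.
move=> Pg; apply: ge_inf; last by exists g.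
have coord_bounded c : exists M, forall h, P d A h -> `|coord h c| <= M.
  have [M MP] := P_pointwise_bounded hd hA c.1; exists M => h /MP/andP[h0 hM].
  by rewrite /coord; case: c.2; rewrite ?normrN ger0_norm.
have [Ma aP] := coord_bounded a; have [Mb bP] := coord_bounded b.
exists (- Mb - Ma) => _ [h Ph <-].
by have := aP _ Ph; have := bP _ Ph; rewrite !ler_norml => /andP[? ?] /andP[? ?]; lra.
Qed.

Lemma le_min_diff m b a :
  (forall g, P d A g -> m <= coord g b - coord g a) -> m <= min_diff b a.
Proof.
move=> mP; apply: lb_le_inf; last by move=> _ [g Pg <-]; exact: mP.
have [f [Ef Af]] := hA; exists (coord f b - coord f a), f => //.
by split=> // p; rewrite -Af.
Qed.

Lemma min_diff_triangle c b a : min_diff c b + min_diff b a <= min_diff c a.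
Proof.
apply: le_min_diff => g Pg.
by have := min_diff_le c b Pg; have := min_diff_le b a Pg; lra.
Qed.

(** [q] need not change sign under the swap of signs; taking half the difference restores this while
    averaging two valid bounds. *)
Lemma P_of_coord (q : X * bool -> R) :
  (forall a c, min_diff a c <= q a - q c) ->
  P d A (fun x => (q (x, true) - q (x, false)) / 2).
Proof.
move=> qP; have Pslack g := (PE g hA).1.
have ge p : 0 <= slack d p (fun x => (q (x, true) - q (x, false)) / 2).
  have := qP (p.1, true) (p.2, false); have := qP (p.2, true) (p.1, false).
  have l1 : d p.1 p.2 <= min_diff (p.1, true) (p.2, false).
    by apply: le_min_diff => g /Pslack[_ /(_ p)]; rewrite /slack /coord /=; lra.
  have l2 : d p.1 p.2 <= min_diff (p.2, true) (p.1, false).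
    by apply: le_min_diff => g /Pslack[_ /(_ p)]; rewrite /slack /coord /=; lra.
  by rewrite /slack; lra.
apply/(PE _ hA); split=> // p Ap; apply/eqP; rewrite eq_le ge andbT.
(* On pairs of [A] the defining equality also gives the opposite bounds, with the signs
   exchanged. *)
have := qP (p.1, false) (p.2, true); have := qP (p.2, false) (p.1, true).
have l1 : - d p.1 p.2 <= min_diff (p.1, false) (p.2, true).
  by apply: le_min_diff => g /Pslack[/(_ p Ap) + _]; rewrite /slack /coord /=; lra.
have l2 : - d p.1 p.2 <= min_diff (p.2, false) (p.1, true).
  by apply: le_min_diff => g /Pslack[/(_ p Ap) + _]; rewrite /slack /coord /=; lra.
by rewrite /slack; lra.
Qed.

Lemma P_injective : injective_sup (P d A).
Proof.
move=> Y dY [d0 [dC dtri]] T f Tf flip.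
have dY0 y : dY y y = 0 by apply/d0.
have dYge y y' : 0 <= dY y y'.
  by have := dtri y y' y; rewrite dY0 (dC y' y); lra.
have [[k0 Tk0]|noT] := pselect (exists k, T k); last first.
  have [g [Eg Ag]] := hA.
  exists (fun=> g); split; first by move=> _; split=> // p; rewrite -Ag.
  split; first by move=> y Ty; case: noT; exists y.
  by move=> y y'; apply: supdist_le => // x; rewrite subrr normr0.
have coord_lip k l a : T k -> T l -> coord (f k) a <= coord (f l) a + dY k l.
  move=> Tk Tl; have [_ Hk] := Tf _ Tk; have [_ Hl] := Tf _ Tl.
  (* Finite rank bounds the difference, so the supremum distance controls every coordinate. *)
  have [B _ BP] := H_bounded hrk Hk Hl.
  have := le_trans (le_supdist a.1 BP) (flip _ _ Tk Tl).
  by rewrite ler_norml /coord => /andP[? ?]; case: a.2; lra.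
pose S y a := [set z | exists k b, T k /\ z = coord (f k) b + dY y k - min_diff b a].
pose q y a := inf (S y a).
(* Any [l] in [T] makes the infimum finite; [l = y] later gives the lower half of the extension
   property. *)
have S_lb y a l : T l -> lbound (S y a) (coord (f l) a - dY y l).
  move=> Tl _ [k [b [Tk ->]]].
  have := min_diff_le b a (Tf _ Tk); have := coord_lip _ _ a Tl Tk.
  by have := dtri l y k; rewrite (dC l y); lra.
have S_nonempty y a : S y a !=set0.
  by exists (coord (f k0) a + dY y k0 - min_diff a a), k0, a.
have q_le y a k b : T k -> q y a <= coord (f k) b + dY y k - min_diff b a.
  move=> Tk; apply: ge_inf; last by exists k, b.
  by exists (coord (f k0) a - dY y k0); exact: S_lb.
(* Compare elements with the same [k] and [b], using the reversed triangle inequality of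
   [min_diff]. *)
have q_diff y a c : min_diff a c <= q y a - q y c.
  suff : min_diff a c + q y c <= q y a by lra.
  apply: lb_le_inf => // _ [k [b [Tk ->]]].
  by have := q_le y c k b Tk; have := min_diff_triangle b a c; lra.
have q_lip y y' a : q y a <= q y' a + dY y y'.
  suff : q y a - dY y y' <= q y' a by lra.
  apply: lb_le_inf => // _ [k [b [Tk ->]]].
  by have := q_le y a k b Tk; have := dtri y y' k; lra.
have q_ext y a : T y -> q y a = coord (f y) a.
  move=> Ty; apply/eqP; rewrite eq_le; apply/andP; split.
    have : 0 <= min_diff a a by apply: le_min_diff => g _; rewrite subrr.
    by have := q_le y a y a Ty; rewrite dY0; lra.
  by apply: lb_le_inf => //; have := S_lb y a y Ty; rewrite dY0 subr0.
exists (fun y x => (q y (x, true) - q y (x, false)) / 2); split; last split.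
- by move=> y; apply: P_of_coord.
- move=> y Ty; apply/funext => x; rewrite !q_ext // /coord /=.
  by field.
- move=> y y'; apply: supdist_le => // x; rewrite ler_norml.
  have := q_lip y y' (x, true); have := q_lip y y' (x, false).
  have := q_lip y' y (x, true); have := q_lip y' y (x, false).
  by rewrite (dC y' y) => ? ? ? ?; apply/andP; split; lra.
Qed.

End Injectivity.

Theorem theorem4p3 (R : realType) (X : Type) (d : X -> X -> R)
  (hd : is_metric d) (hint : int_valued d)
  (A : set (X * X)) (hA : scrA d A) (n : nat) (hn : (1 <= n)%N)
  (hrk : rk_eq d A n) :
  (is_polytope (P d A) /\ affine_dim (P d A) n /\ injective_sup (P d A)) /\
  (forall g, rel_interior (H d A) (P d A) g <-> (Eprime d g /\ Aset d g = A)) /\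
  (forall F, is_face (P d A) F <->
     exists A', scrA d A' /\ A `<=` A' /\ F = P d A').
Proof.
have [f [[Df cov] Af]] := hA.
have Hf : H d A f by move=> p; rewrite -Af.
have [K [pr hK]] := finite_slacks hint hrk Hf Df.
split; first split; last split.
- exact: P_polytope hd hA hK.
- by split; [exact: P_affine_dim hA hrk hK|exact: P_injective hd hA hrk].
- exact: P_rel_interior hA hrk hK.
- move=> F; split; first exact: face_P hd hA hK F.
  by move=> [A' [hA' [AA' ->]]]; exact: P_face.
Qed.
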